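(* Let $\Omega_0$ be the set of all countable ordinals and let $\Omega=\Omega_0\cup\{\omega_1\}$, where $\omega_1$ is the first uncountable ordinal. There exist two injective maps $$i_L:\Omega\to\overline{ASDIM},\qquad i_s:\Omega\to\overline{SMDIM}$$ such that each $i_L(\alpha)$ (respectively $i_s(\alpha)$) is mono-bounded at $\infty$ (respectively at $0$) if $\alpha\in\Omega_0$, and moreover $i_L(\beta)\prec i_L(\alpha)$ (respectively $i_s(\beta)\prec i_s(\alpha)$) for every pair of ordinals $\alpha<\beta$ in $\Omega$. (Here mono-boundedness and $\prec$ refer to suitable representatives: there are large scale control semigroups $\mathcal S_\alpha$ and small scale control semigroups $\xi_\alpha$, $\alpha\in\Omega$, with $i_L(\alpha)$ the class of $\mathcal S_\alpha$ and $i_s(\alpha)$ the class of $\xi_\alpha$, such that $\mathcal S_\alpha$ and $\xi_\alpha$ are mono-bounded for $\alpha\in\Omega_0$ and $\mathcal S_\beta\prec\mathcal S_\alpha$, $\xi_\beta\prec\xi_\alpha$ for $\alpha<\beta$.)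
   Context: $\mathbb R_+=[0,\infty)$. A property $P(s)$ of positive reals holds in a neighborhood of $\infty$ (resp. of $0$) if there is $s_0>0$ such that it holds for all $s\ge s_0$ (resp. all $s\le s_0$). A large scale (asymptotic) dim-control function is an increasing continuous $f:\mathbb R_+\to\mathbb R_+$ with $f(x)\ge x$ in a neighborhood of $\infty$ and $\lim_{x\to\infty}f(x)=\infty$. A small scale dim-control function is an increasing continuous $f:\mathbb R_+\to\mathbb R_+$ with $f(x)\ge x$ in a neighborhood of $0$ and $f(0)=0$. Such a function is large scale (resp. small scale) linear if it equals some linear function in a neighborhood of $\infty$ (resp. of $0$). A large scale (resp. small scale) control semigroup is a set of large scale (resp. small scale) dim-control functions that contains every large scale (resp. small scale) linear dim-control function and is closed under composition. For large scale (resp. small scale) control semigroups, $\mathcal S_1\preceq\mathcal S_2$ means: for every $f\in\mathcal S_2$ there is $g\in\mathcal S_1$ with $f\le g$ in a neighborhood of $\infty$ (resp. of $0$). $\mathcal S_1\approx\mathcal S_2$ means $\mathcal S_1\preceq\mathcal S_2$ and $\mathcal S_2\preceq\mathcal S_1$; $\mathcal S_1\prec\mathcal S_2$ means $\mathcal S_1\preceq\mathcal S_2$ and not $\mathcal S_1\approx\mathcal S_2$. A large scale (resp. small scale) control semigroup $\mathcal S$ is mono-bounded at $\infty$ (resp. at $0$) if there is a large scale (resp. small scale) dim-control function $f$ such that for every $g\in\mathcal S$ one has $f(x)>g(x)$ in a neighborhood of $\infty$ (resp. for all sufficiently small $x>0$). A family of subsets of a metric space is $s$-disjoint if $d(U,V)>s$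 for any two distinct members $U,V$, and $C$-bounded if every member has diameter $\le C$. For a large scale (resp. small scale) control semigroup $\mathcal S$, write $asdim_{\mathcal S}X\le n$ (resp. $smdim_{\mathcal S}X\le n$) if there is $f\in\mathcal S$ such that for every $s$ in some neighborhood of $\infty$ (resp. of $0$) there is a cover $\mathcal U=\bigcup_{i=1}^{n+1}\mathcal U_i$ of $X$ with each $\mathcal U_i$ $s$-disjoint and $f(s)$-bounded; the dimension is the least such $n$ ($\infty$ if none). Two large scale (resp. small scale) control semigroups are dim-equivalent ($\equiv$) if the associated dimensions $asdim$ (resp. $smdim$) agree on every metric space. $\overline{ASDIM}$ (resp. $\overline{SMDIM}$) is the quotient of the set of all large scale (resp. small scale) control semigroups by $\equiv$. *)

(* Defs.v *)
From HB Require Import structures.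
From mathcomp Require Import all_boot all_order all_algebra.
From mathcomp Require Import all_classical all_reals all_analysis.
From mathcomp Require wochoice.

Set Implicit Arguments.
Unset Strict Implicit.
Unset Printing Implicit Defensive.

Import Order.TTheory GRing.Theory Num.Theory.
Import numFieldNormedType.Exports.

Local Open Scope classical_set_scope.
Local Open Scope ring_scope.
Local Open Scope quotient_scope.

(** A countable ordinal is the order type of a well-order on a subset of [nat];
    [wo_le] is the reflexive order and is irrelevant outside [wo_dom]. *)
Record nat_well_order : Type := NatWellOrder {
  wo_dom : {pred nat};
  wo_le : rel nat;
  wo_leP : wochoice.wo_chain wo_le wo_dom }.

HB.instance Definition _ := gen_eqMixin nat_well_order.
HB.instance Definition _ := gen_choiceMixin nat_well_order.

Definition order_iso (A : {pred nat}) (r : rel nat) (B : {pred nat})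
    (s : rel nat) : Prop :=
  exists2 f : nat -> nat, set_bij [set` A] [set` B] f &
    {in A &, {mono f : x y / r x y >-> s x y}}.

Lemma order_iso_refl A r : order_iso A r A r.
Proof. by exists id => [|x y xA yA]; [split=> [||x xA] ; [| |exists x]|]. Qed.

Lemma order_iso_sym A r B s : order_iso A r B s -> order_iso B s A r.
Proof.
move=> [f [fAB finj fsurj] fmono].
have /choice[g gP] : forall y, exists x, y \in B -> x \in A /\ f x = y.
  move=> y; case: (boolP (y \in B)) => [yB|_]; last by exists 0%N.
  by have [x xA <-] := fsurj y yB; exists x.
exists g => [|x y xB yB]; last first.
  have [gxA fgx] := gP _ xB; have [gyA fgy] := gP _ yB.
  by rewrite -fmono // fgx fgy.
split=> [y yB|x y|x xA].
- by have [] := gP y yB.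
- rewrite !inE => /= xB yB gxy.
  by have [_ <-] := gP x xB; have [_ <-] := gP y yB; rewrite gxy.
- have fxB : f x \in B by exact: fAB.
  exists (f x) => //; have [gA fg] := gP _ fxB.
  by apply: finj => //; rewrite inE.
Qed.

Lemma order_iso_trans A r B s C t :
  order_iso A r B s -> order_iso B s C t -> order_iso A r C t.
Proof.
move=> [f [fAB finj fsurj] fmono] [g [gBC ginj gsurj] gmono].
exists (g \o f) => [|x y xA yA /=]; last first.
  by rewrite gmono ?fmono //; exact: fAB.
split=> [x xA|x y|z zC].
- by apply: gBC; exact: fAB.
- rewrite !inE => /= xA yA /ginj e; apply: finj; rewrite ?inE //.
  by apply: e; rewrite inE; exact: fAB.
- have [y yB <-] := gsurj z zC; have [x xA <-] := fsurj y yB.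
  by exists x.
Qed.

Definition same_order_type (u v : nat_well_order) : bool :=
  `[< order_iso (wo_dom u) (@wo_le u) (wo_dom v) (@wo_le v) >].

Lemma same_order_type_refl : reflexive same_order_type.
Proof. by move=> u; apply/asboolP; exact: order_iso_refl. Qed.

Lemma same_order_type_sym : symmetric same_order_type.
Proof.
by move=> u v; apply/asboolP/asboolP; exact: order_iso_sym.
Qed.

Lemma same_order_type_trans : transitive same_order_type.
Proof.
move=> v u w /asboolP uv /asboolP vw; apply/asboolP.
exact: order_iso_trans uv vw.
Qed.

Canonical same_order_type_equiv := EquivRel same_order_type
  same_order_type_refl same_order_type_sym same_order_type_trans.

Definition countable_ordinal : Type := {eq_quot same_order_type}.

Definition initial_segment (u : nat_well_order) (b : nat) : {pred nat} :=
  [pred x | [&& x \in wo_dom u, wo_le u x b & x != b]].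

Definition shorter (u v : nat_well_order) : Prop :=
  exists2 b, b \in wo_dom v &
    order_iso (wo_dom u) (@wo_le u) (initial_segment v b) (@wo_le v).

Definition countable_ordinal_lt (a b : countable_ordinal) : Prop :=
  exists u v : nat_well_order,
    [/\ \pi_countable_ordinal u = a, \pi_countable_ordinal v = b & shorter u v].

(** The set of the ordinals at most omega_1: [None] is omega_1. *)
Definition Omega : Type := option countable_ordinal.

Definition Omega_lt (a b : Omega) : Prop :=
  match a, b with
  | Some a, Some b => countable_ordinal_lt a b
  | Some _, None => True
  | None, _ => False
  end.

Variant scale := Large | Small.

Definition Rplus (R : realType) : set R := [set x | 0 <= x].
Arguments Rplus : clear implicits.

(** [P] holds in a neighborhood of infinity (resp. of 0). *)
Definition near_scale (R : realType) (c : scale) (P : Rplus R -> Prop) : Prop :=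
  exists2 s0 : R, 0 < s0 & forall s : Rplus R,
    match c with Large => s0 <= \val s | Small => 0 < \val s <= s0 end -> P s.

(** "Increasing" is read as strictly increasing; the continuity is for the
    subspace topology of [Rplus R]. *)
Definition dim_control (R : realType) (c : scale) (f : Rplus R -> Rplus R) :
    Prop :=
  [/\ forall x y : Rplus R, \val x < \val y -> \val (f x) < \val (f y),
      continuous f,
      near_scale c (fun x => \val x <= \val (f x)) &
      match c with
      | Large => forall M : R, near_scale Large (fun x => M <= \val (f x))
      | Small => forall x : Rplus R, \val x = 0 -> \val (f x) = 0
      end].

(** A linear function is some [x |-> a * x + b], as usual for asymptotic
    dimension of linear type; at small scale [f 0 = 0] forces [b = 0]. *)
Definition scale_linear (R : realType) (c : scale) (f : Rplus R -> Rplus R) :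
    Prop :=
  exists a b : R, near_scale c (fun x => \val (f x) = a * \val x + b).

Record control_semigroup (R : realType) (c : scale) : Type :=
  ControlSemigroup {
    csg_set : set (Rplus R -> Rplus R);
    csg_control : forall f, csg_set f -> dim_control c f;
    csg_linear : forall f, dim_control c f -> scale_linear c f -> csg_set f;
    csg_comp : forall f g, csg_set f -> csg_set g -> csg_set (f \o g) }.

Definition csg_le (R : realType) (c : scale) (S1 S2 : control_semigroup R c) :
    Prop :=
  forall f, csg_set S2 f ->
    exists2 g, csg_set S1 g & near_scale c (fun x => \val (f x) <= \val (g x)).

Definition csg_approx (R : realType) (c : scale)
    (S1 S2 : control_semigroup R c) : Prop :=
  csg_le S1 S2 /\ csg_le S2 S1.

Definition csg_lt (R : realType) (c : scale) (S1 S2 : control_semigroup R c) :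
    Prop :=
  csg_le S1 S2 /\ ~ csg_approx S1 S2.

Definition mono_bounded (R : realType) (c : scale) (S : control_semigroup R c) :
    Prop :=
  exists2 f, dim_control c f & forall g, csg_set S g ->
    near_scale c (fun x => \val (g x) < \val (f x)).

(** The values are extended reals: [set_dist] is [+oo] if [U] or [V] is empty,
    and [diameter set0] is [-oo], so that [set0] is always [C]-bounded. *)
Definition set_dist (R : realType) (X : metricType R) (U V : set X) : \bar R :=
  ereal_inf [set (mdist x y)%:E | x in U & y in V].

Definition diameter (R : realType) (X : metricType R) (U : set X) : \bar R :=
  ereal_sup [set (mdist x y)%:E | x in U & y in U].

Definition disjoint_family (R : realType) (X : metricType R) (s : R)
    (F : set (set X)) : Prop :=
  forall U V, F U -> F V -> U <> V -> (s%:E < set_dist U V)%E.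

Definition bounded_family (R : realType) (X : metricType R) (C : R)
    (F : set (set X)) : Prop :=
  forall U, F U -> (diameter U <= C%:E)%E.

(** [sdim_le S X n] is [asdim_S X <= n] or [smdim_S X <= n], according to the
    scale of [S]. *)
Definition sdim_le (R : realType) (c : scale) (S : control_semigroup R c)
    (X : metricType R) (n : nat) : Prop :=
  exists2 f, csg_set S f & near_scale c (fun s =>
    exists U : 'I_n.+1 -> set (set X),
      \bigcup_(A in \bigcup_i U i) A = [set: X] /\
      forall i, disjoint_family (\val s) (U i) /\
                bounded_family (\val (f s)) (U i)).

(** The least [n] with [sdim_le S X n], and [+oo] if there is none. *)
Definition sdim (R : realType) (c : scale) (S : control_semigroup R c)
    (X : metricType R) : \bar R :=
  ereal_inf [set n%:R%:E | n in sdim_le S X].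

Definition dim_equiv (R : realType) (c : scale) (S1 S2 : control_semigroup R c) :
    bool :=
  `[< forall X : metricType R, sdim S1 X = sdim S2 X >].

Lemma dim_equiv_refl (R : realType) (c : scale) : reflexive (@dim_equiv R c).
Proof. by move=> S; apply/asboolP. Qed.

Lemma dim_equiv_sym (R : realType) (c : scale) : symmetric (@dim_equiv R c).
Proof. by move=> S1 S2; apply/asboolP/asboolP => H X. Qed.

Lemma dim_equiv_trans (R : realType) (c : scale) : transitive (@dim_equiv R c).
Proof.
by move=> S2 S1 S3 /asboolP H12 /asboolP H23; apply/asboolP => X; rewrite H12.
Qed.

Canonical dim_equiv_equiv (R : realType) (c : scale) :=
  EquivRel (@dim_equiv R c) (@dim_equiv_refl R c) (@dim_equiv_sym R c)
    (@dim_equiv_trans R c).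

HB.instance Definition _ (R : realType) (c : scale) :=
  gen_eqMixin (control_semigroup R c).
HB.instance Definition _ (R : realType) (c : scale) :=
  gen_choiceMixin (control_semigroup R c).

Definition ASDIM (R : realType) : Type := {eq_quot @dim_equiv R Large}.
Definition SMDIM (R : realType) : Type := {eq_quot @dim_equiv R Small}.

Definition asdim_class (R : realType) (S : control_semigroup R Large) :
    ASDIM R := \pi S.
Definition smdim_class (R : realType) (S : control_semigroup R Small) :
    SMDIM R := \pi S.

(* Main.v *)
(** Any countable family of dim-control functions is strictly dominated near the
    scale by a single one.  Well-founded recursion along the countable ordinals
    therefore yields dim-control functions [F a] such that [F b] dominates every
    iterate of [F a] for [a < b], and [F a x >= 2 x]; the semigroup of [a] consists
    of the functions dominated by an iterate of [F a], and that of omega_1 of all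
    dim-control functions.  For injectivity, if [g] in [S2] is not dominated by
    [S1], a space made of [s]-chains of length about [g s], one for each [s],
    pairwise far apart, has dimension 0 for [S2] but not for [S1]; hence
    dim-equivalent semigroups are equivalent for the order. *)

Require Import Defs.
From HB Require Import structures.
From mathcomp Require Import all_boot all_order all_algebra.
From mathcomp Require Import all_classical all_reals all_analysis.
From mathcomp Require Import lra.
From mathcomp Require wochoice.

Set Implicit Arguments.
Unset Strict Implicit.
Unset Printing Implicit Defensive.

Import Order.TTheory GRing.Theory Num.Theory.
Import numFieldNormedType.Exports.

Local Open Scope classical_set_scope.
Local Open Scope ring_scope.
Local Open Scope quotient_scope.

(** * Countable ordinals *)

Section NatWellOrders.
Implicit Types u v : nat_well_order.

Lemma wo_le_refl u : {in wo_dom u, reflexive (@wo_le u)}.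
Proof. exact/wochoice.wo_chain_reflexive/wo_leP. Qed.

Lemma wo_le_total u : {in wo_dom u &, total (@wo_le u)}.
Proof. exact/wochoice.wo_chainW/wo_leP. Qed.

Lemma wo_le_anti u : {in wo_dom u &, antisymmetric (@wo_le u)}.
Proof. exact/wochoice.wo_chain_antisymmetric/wo_leP. Qed.

(** [wo_chain] gives every nonempty subset of the domain a unique least element. Apply this to the
    set of the three points: if the least is [x], done; if it is [y] or [z], antisymmetry identifies
    two of them. *)
Lemma wo_le_trans u : {in wo_dom u & &, transitive (@wo_le u)}.
Proof.
move=> y x z yD xD zD xy yz.
have sub : {subset [:: x; y; z] <= wo_dom u}.
  by move=> t; rewrite !inE => /or3P[]/eqP->.
have ne : wochoice.nonempty [in [:: x; y; z]] by exists x; rewrite !inE eqxx.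
have [t [[tC tmin] _]] := wo_leP sub ne.
have [tx ty tz] : [/\ wo_le u t x, wo_le u t y & wo_le u t z].
  by split; apply: tmin; rewrite !inE eqxx ?orbT.
move: tC; rewrite !inE => /or3P[]/eqP e; first by rewrite -e.
- have -> // : x = y by apply: (@wo_le_anti u) => //; rewrite xy -e tx.
- have <- // : y = z by apply: (@wo_le_anti u) => //; rewrite yz -e ty.
Qed.

Lemma initial_segmentE u b x :
  (x \in initial_segment u b) = [&& x \in wo_dom u, wo_le u x b & x != b].
Proof. by []. Qed.

Lemma initial_segment_wo u b : wochoice.wo_chain (@wo_le u) (initial_segment u b).
Proof.
apply: wochoice.sub_within (@wo_leP u) => x.
by rewrite initial_segmentE => /and3P[].
Qed.

Definition segment u b := NatWellOrder (@initial_segment_wo u b).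

Lemma wo_dom_segment u b : {subset wo_dom (segment u b) <= wo_dom u}.
Proof. by move=> x; rewrite initial_segmentE => /and3P[]. Qed.

Lemma segment_segment u b c : b \in wo_dom u -> c \in wo_dom (segment u b) ->
  initial_segment (segment u b) c = initial_segment u c.
Proof.
move=> bD; rewrite initial_segmentE => /and3P[cD cb cNb].
apply/funext => x; apply/idP/idP; rewrite /initial_segment /=.
  by case/and3P => /and3P[-> _ _] -> ->.
case/and3P => xD xc xNc; rewrite inE /= xD xc xNc (wo_le_trans cD xD bD) //=.
rewrite andbT; apply: contra_neq cNb => xb.
by apply: (@wo_le_anti u) => //; rewrite cb -xb.
Qed.

Lemma order_iso_segment u v f b : b \in wo_dom u ->
    set_bij [set` wo_dom u] [set` wo_dom v] f ->
    {in wo_dom u &, {mono f : x y / wo_le u x y >-> wo_le v x y}} ->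
  order_iso (initial_segment u b) (@wo_le u)
            (initial_segment v (f b)) (@wo_le v).
Proof.
move=> bD [fD finj fsurj] fm.
have inj x y : x \in wo_dom u -> y \in wo_dom u -> f x = f y -> x = y.
  by move=> xD yD; apply: finj; rewrite inE.
exists f; last by move=> x y /wo_dom_segment xD /wo_dom_segment yD; exact: fm.
split=> [x /=|x y|y /=].
- rewrite !initial_segmentE => /and3P[xD xb xNb].
  rewrite fm // xb (fD _ xD) /=; apply: contra_neq xNb; exact: inj.
- by rewrite !inE /= => /wo_dom_segment xD /wo_dom_segment yD; exact: inj.
- rewrite initial_segmentE => /and3P[/fsurj[x /= xD <-]].
  rewrite fm // => xb xNb; exists x => //=; rewrite initial_segmentE.
  by rewrite xD xb; apply: contra_neq xNb => ->.
Qed.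

Definition type_of u : countable_ordinal := \pi u.

Lemma type_of_eqP u v : reflect
  (order_iso (wo_dom u) (@wo_le u) (wo_dom v) (@wo_le v)) (type_of u == type_of v).
Proof.
apply: (iffP eqP) => [/eqmodP/asboolP//|uv].
by apply/eqmodP/asboolP.
Qed.

Lemma type_ofW (P : countable_ordinal -> Prop) :
  (forall u, P (type_of u)) -> forall a, P a.
Proof. by move=> H a; rewrite -[a]reprK; exact: H. Qed.

(** The order on classes quantifies over representatives of both sides. Transporting segments along
    an isomorphism allows one fixed representative [v], on which all later arguments take place. *)
Lemma lt_type_ofP a v : countable_ordinal_lt a (type_of v) <->
  exists2 b, b \in wo_dom v & a = type_of (segment v b).
Proof.
split=> [[u [w [<- wv [b bD ub]]]]|[b bD ->]]; last first.
  exists (segment v b), v; split=> //; exists b => //; exact: order_iso_refl.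
have /eqP/type_of_eqP[f fb fm] : type_of w = type_of v by [].
exists (f b); first by case: fb => + _ _; exact.
apply/eqP/type_of_eqP/(order_iso_trans ub); exact: order_iso_segment.
Qed.

Lemma type_of_segment_segment u b c : b \in wo_dom u ->
  c \in wo_dom (segment u b) ->
  type_of (segment (segment u b) c) = type_of (segment u c).
Proof.
move=> bD cD; apply/eqP/type_of_eqP; rewrite /= segment_segment //.
exact: order_iso_refl.
Qed.

Lemma countable_ordinal_lt_wf : well_founded countable_ordinal_lt.
Proof.
elim/type_ofW => v.
have segA b : b \in wo_dom v -> Acc countable_ordinal_lt (type_of (segment v b)).
  apply: contraPP => bN bD.
  (* Minimal counterexample: the endpoints of inaccessible segments have a least element [z], yet
     everything below [segment v z] is a segment ending before [z], hence accessible. *)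
  pose C : {pred nat} := [pred x | (x \in wo_dom v) &&
    ~~ `[< Acc countable_ordinal_lt (type_of (segment v x)) >]].
  have ne : wochoice.nonempty C by exists b; rewrite inE bD; apply/asboolP.
  have sub : {subset C <= wo_dom v} by move=> x /andP[].
  have [z [[zC zmin] _]] := wo_leP sub ne.
  have /andP[zD /asboolP[]] := zC; constructor => a /lt_type_ofP[c czD ->].
  rewrite (type_of_segment_segment zD czD).
  have /and3P[cD cz cNz] := czD; apply: contrapT => cN.
  have cC : c \in C by rewrite inE cD; apply/asboolP.
  by move/eqP: cNz; apply; apply: (@wo_le_anti v) => //; rewrite cz zmin.
by constructor => a /lt_type_ofP[b bD ->]; exact: segA.
Qed.

Lemma countable_ordinal_ltxx a : ~ countable_ordinal_lt a a.
Proof. by elim: {a}(countable_ordinal_lt_wf a) => a _ IH /[dup]/IH. Qed.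

Lemma countable_ordinal_lt_trans a b c :
  countable_ordinal_lt a b -> countable_ordinal_lt b c ->
  countable_ordinal_lt a c.
Proof.
elim/type_ofW: c => w ab /lt_type_ofP[y yD be]; move: ab; rewrite be.
case/lt_type_ofP => x xD ->; apply/lt_type_ofP; exists x.
  exact: wo_dom_segment xD.
exact: type_of_segment_segment.
Qed.

(** Each predecessor is a segment cut at a natural number. This is what makes strict bounds of
    countable families available at every stage of the recursion. *)
Lemma countable_initial a : countable [set b | countable_ordinal_lt b a].
Proof.
elim/type_ofW: a => v.
apply: (@sub_countable _ _ _ (range (fun b => type_of (segment v b)))).
  by apply: subset_card_le => a /lt_type_ofP[b _ ->]; exists b.
by apply: card_image_le.
Qed.

Lemma lt_type_of_segment u x y : x \in wo_dom u -> y \in wo_dom u ->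
  countable_ordinal_lt (type_of (segment u x)) (type_of (segment u y)) <->
  wo_le u x y && (x != y).
Proof.
move=> xD yD.
have lt x' y' : x' \in wo_dom u -> y' \in wo_dom u -> wo_le u x' y' ->
    x' != y' ->
    countable_ordinal_lt (type_of (segment u x')) (type_of (segment u y')).
  move=> xD' yD' xy xNy; have xy' : x' \in wo_dom (segment u y').
    by rewrite initial_segmentE xD' xy.
  apply/lt_type_ofP; exists x' => //.
  by rewrite type_of_segment_segment.
split=> [xy|/andP[]]; last exact: lt.
have xNy : x != y.
  by apply: contraPneq xy => ->; exact: countable_ordinal_ltxx.
rewrite xNy andbT; have /orP[//|yx] := wo_le_total xD yD.
case: (@countable_ordinal_ltxx (type_of (segment u x))).
by apply: countable_ordinal_lt_trans xy _; apply: lt; rewrite // eq_sym.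
Qed.

Lemma type_of_segment_inj u :
  {in wo_dom u &, injective (fun x => type_of (segment u x))}.
Proof.
move=> x y xD yD exy; apply: contrapT => /eqP xNy.
have [xy|yx] := orP (wo_le_total xD yD).
  have := (lt_type_of_segment xD yD).2; rewrite xy xNy exy => /(_ isT).
  exact: countable_ordinal_ltxx.
have := (lt_type_of_segment yD xD).2; rewrite yx eq_sym xNy exy => /(_ isT).
exact: countable_ordinal_ltxx.
Qed.

(** Match [x] with the [y] whose segment has the same type. An endpoint is determined by the type of
    its segment, so this matching is an isomorphism of the representatives. *)
Lemma countable_ordinal_ext a b :
  (forall c, countable_ordinal_lt c a <-> countable_ordinal_lt c b) -> a = b.
Proof.
elim/type_ofW: a => u; elim/type_ofW: b => v uv.
have /choice[f fP] : forall x, exists y, x \in wo_dom u ->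
    y \in wo_dom v /\ type_of (segment u x) = type_of (segment v y).
  move=> x; case: (boolP (x \in wo_dom u)) => [xD|_]; last by exists 0%N.
  have /lt_type_ofP[y yD exy] : countable_ordinal_lt (type_of (segment u x)) (type_of v).
    by apply/uv/lt_type_ofP; exists x.
  by exists y.
apply/eqP/type_of_eqP; exists f; last first.
  move=> x y xD yD; have [fxD ex] := fP _ xD; have [fyD ey] := fP _ yD.
  have [->|xNy] := eqVneq x y; first by rewrite !wo_le_refl.
  have fxNy : f x != f y.
    apply: contra_neq xNy => fxy; apply: (@type_of_segment_inj u) => //.
    by rewrite ex ey fxy.
  have := lt_type_of_segment xD yD; have := lt_type_of_segment fxD fyD.
  rewrite -ex -ey xNy fxNy !andbT => h1 h2.
  by apply/idP/idP => [/h1/h2|/h2/h1].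
split=> [x xD|x y|y yD].
- by have [] := fP x xD.
- rewrite !inE /= => xD yD fxy; have [_ ex] := fP _ xD; have [_ ey] := fP _ yD.
  by apply: (@type_of_segment_inj u) => //; rewrite ex ey fxy.
- have /lt_type_ofP[x xD exy] : countable_ordinal_lt (type_of (segment v y)) (type_of u).
    by apply/uv/lt_type_ofP; exists y.
  exists x => //; have [fxD ex] := fP _ xD.
  by apply: (@type_of_segment_inj v) => //; rewrite exy ex.
Qed.

(** By double well-founded induction: if all three cases failed, the induction hypotheses would give
    [a] and [b] the same predecessors, and extensionality would make them equal. *)
Lemma countable_ordinal_trichotomy a b :
  [\/ countable_ordinal_lt a b, a = b | countable_ordinal_lt b a].
Proof.
elim: {a}(countable_ordinal_lt_wf a) b => a _ IHa b.
elim: {b}(countable_ordinal_lt_wf b) => b _ IHb.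
apply: contrapT => N.
have [Nab Neq Nba] : [/\ ~ countable_ordinal_lt a b, a <> b & ~ countable_ordinal_lt b a].
  by split=> h; apply: N; [constructor 1|constructor 2|constructor 3].
apply: Neq; apply: countable_ordinal_ext => c; split=> [ca|cb].
  have [//|ecb|bc] := IHa c ca b; case: Nba; first by rewrite -ecb.
  exact: countable_ordinal_lt_trans ca.
have [ac|eac|//] := IHb c cb; case: Nab; last by rewrite eac.
exact: countable_ordinal_lt_trans cb.
Qed.

End NatWellOrders.

(** * Dim-control functions *)

Section DimControl.
Context {R : realType}.
Implicit Types (x y : Rplus R) (f g h : Rplus R -> Rplus R) (c : scale).

Lemma Rplus_ge0 x : 0 <= \val x.
Proof. exact: set_mem (valP x). Qed.

Lemma clamp_subproof (r : R) : Num.max 0 r \in Rplus R.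
Proof. by apply/mem_set; rewrite /Rplus/= le_max lexx. Qed.

(** A total map from reals to points of [Rplus R]; it is applied to nonnegative reals, where it
    keeps the value. *)
Definition clamp (r : R) : Rplus R := exist _ (Num.max 0 r) (clamp_subproof r).

Lemma val_clamp (r : R) : 0 <= r -> \val (clamp r) = r.
Proof. by move=> r0 /=; rewrite max_r. Qed.

Lemma Rplus_continuousP f : continuous f <->
  forall x e, 0 < e -> exists2 d, 0 < d &
    forall y, `|\val x - \val y| < d -> `|\val (f x) - \val (f y)| < e.
Proof.
have ballE x e : ball x e = [set y | `|\val x - \val y| < e].
  by rewrite -(@initial_ballE R (Rplus R : Type) R set_val) set_valE.
split=> [fc x e e0|fc x].
  have /cvg_ballP/(_ e e0)/nbhs_ballP[d d0 xd] := fc x.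
  by exists d => // y xy; have := xd y; rewrite !ballE; exact.
apply/cvg_ballP => [|e e0]; first exact: (@nbhs_filter (Rplus R) x).
have [d d0 xd] := fc x e e0.
suff : nbhs x [set y | ball (f x) e (f y)] by [].
by apply/nbhs_ballP; exists d => // y; rewrite /= !ballE /=; exact: xd.
Qed.

Lemma near_scaleT c (P : Rplus R -> Prop) : (forall x, 0 < \val x -> P x) ->
  near_scale c P.
Proof.
move=> PT; exists 1 => // s; case: c => [/(lt_le_trans ltr01)|/andP[+ _]]; exact: PT.
Qed.

Lemma near_scaleS c (P Q : Rplus R -> Prop) :
  (forall x, 0 < \val x -> P x -> Q x) -> near_scale c P -> near_scale c Q.
Proof.
move=> PQ [s0 s00 Ps]; exists s0 => // s sc; apply: PQ (Ps _ sc).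
by case: c {Ps} sc => [/(lt_le_trans s00)|/andP[]].
Qed.

Lemma near_scaleI c (P Q : Rplus R -> Prop) :
  near_scale c P -> near_scale c Q -> near_scale c (fun x => P x /\ Q x).
Proof.
move=> [s s0 Ps] [t t0 Qt].
case: c Ps Qt => Ps Qt.
  exists (Num.max s t) => [|x]; first by rewrite lt_max s0.
  by rewrite ge_max => /andP[sx tx]; split; [exact: Ps|exact: Qt].
exists (Num.min s t) => [|x]; first by rewrite lt_min s0.
rewrite le_min => /and3P[x0 sx tx].
by split; [apply: Ps; rewrite x0|apply: Qt; rewrite x0].
Qed.

Lemma near_scale_ex c (P : Rplus R -> Prop) :
  near_scale c P -> exists2 x, 0 < \val x & P x.
Proof.
move=> [s s0 Ps]; exists (clamp s); rewrite ?val_clamp ?(ltW s0) //.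
by apply: Ps; rewrite val_clamp ?(ltW s0) //; case: c => //; rewrite s0 lexx.
Qed.

Lemma dim_control_lt c f x y : dim_control c f ->
  \val x < \val y -> \val (f x) < \val (f y).
Proof. by case=> + _ _ _; exact. Qed.

Lemma dim_control_le c f x y : dim_control c f ->
  \val x <= \val y -> \val (f x) <= \val (f y).
Proof.
move=> fc; rewrite le_eqVlt => /orP[/eqP/val_inj->//|xy].
exact/ltW/(dim_control_lt fc).
Qed.

Lemma dim_control_gt0 c f x : dim_control c f -> 0 < \val x -> 0 < \val (f x).
Proof.
move=> fc x0; apply: (@le_lt_trans _ _ (\val (f (clamp 0)))).
  exact: Rplus_ge0.
by apply: (dim_control_lt fc); rewrite val_clamp.
Qed.

Lemma dim_control_small f (e : R) : dim_control Small f -> 0 < e ->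
  near_scale Small (fun x => \val (f x) < e).
Proof.
move=> [_ /Rplus_continuousP fc _ f0] e0.
have z0 : \val (clamp 0) = 0 by rewrite val_clamp.
have [d d0 fd] := fc (clamp 0) e e0.
exists (d / 2) => [|x /andP[x0 xd]]; first by rewrite divr_gt0.
have := fd x; rewrite f0 // z0 !sub0r !normrN !ger0_norm ?Rplus_ge0 //; apply.
by apply: le_lt_trans xd _; rewrite ltr_pdivrMr // ltr_pMr // ltr1n.
Qed.

(** A dim-control function tends to the scale: to infinity by the limit condition, to 0 by
    continuity and [f 0 = 0]. This lets inequalities valid near the scale be composed. *)
Lemma near_scale_preimage c f (P : Rplus R -> Prop) : dim_control c f ->
  near_scale c P -> near_scale c (fun x => P (f x)).
Proof.
move=> fc [s s0 Ps]; case: c fc Ps => fc Ps.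
  have [_ _ _ /(_ s)] := fc.
  by apply: near_scaleS => x _; exact: Ps.
apply: near_scaleS (dim_control_small fc s0) => x x0 fxs.
by apply: Ps; rewrite (dim_control_gt0 fc x0) ltW.
Qed.

Lemma dim_control_ge c f : dim_control c f ->
  near_scale c (fun x => \val x <= \val (f x)).
Proof. by case. Qed.

Lemma dim_control_id c : dim_control c (@id (Rplus R)).
Proof.
split => //; first by move=> x; exact: cvg_id.
  exact: near_scaleT.
case: c => // M; exists (Num.max 1 M) => [|x]; first by rewrite lt_max ltr01.
by rewrite ge_max => /andP[].
Qed.

Lemma dim_control_comp c f g : dim_control c f -> dim_control c g ->
  dim_control c (f \o g).
Proof.
move=> fc gc; split.
- by move=> x y xy /=; apply: (dim_control_lt fc); exact: dim_control_lt gc xy.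
- move=> x; apply: continuous_comp; first by case: gc => _ + _ _; exact.
  by case: fc => _ + _ _; exact.
- have := near_scaleI (dim_control_ge gc) (near_scale_preimage gc (dim_control_ge fc)).
  by apply: near_scaleS => x _ [] /le_trans; exact.
- case: c fc gc => fc gc.
    by move=> M; have [_ _ _ /(_ M)] := fc; exact: near_scale_preimage.
  by move=> x x0 /=; have [_ _ _ f0] := fc; have [_ _ _ g0] := gc; apply/f0/g0.
Qed.

Lemma dim_control_iter c f n : dim_control c f -> dim_control c (iter n f).
Proof.
move=> fc; elim: n => [|n IH]; first exact: dim_control_id.
exact: (@dim_control_comp c f _ fc IH).
Qed.

End DimControl.

(** * Strict bounds of countable families *)

Section Bounds.
Context {R : realType}.
Implicit Types (x y : Rplus R) (f g h : Rplus R -> Rplus R) (c : scale).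

Lemma continuous_add (T : topologicalType) (phi psi : T -> R) :
  continuous phi -> continuous psi -> continuous (fun t => phi t + psi t).
Proof. by move=> phic psic t; apply: cvgD; [exact: phic|exact: psic]. Qed.

Lemma near_eq_continuous_at (T : topologicalType) (V : set T) (phi psi : T -> R) t :
  nbhs t V -> {in V, phi =1 psi} -> {for t, continuous phi} ->
  {for t, continuous psi}.
Proof.
move=> tV e phic; have et := e t (mem_set (nbhs_singleton tV)).
rewrite /prop_for /continuous_at -et; apply: cvg_trans phic.
by apply: near_eq_cvg; apply: filterS tV => u /mem_set/e.
Qed.

Lemma val_Rplus_continuous : continuous (fun x : Rplus R => \val x : R).
Proof. exact: (@initial_continuous (Rplus R : Type) R set_val). Qed.

Lemma clamp_continuous (phi : Rplus R -> R) : (forall x, 0 <= phi x) ->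
  continuous phi -> continuous (fun x => clamp (phi x)).
Proof.
move=> phi0 phic; apply/Rplus_continuousP => x e e0.
have ballE x' e' : ball x' e' = [set y | `|\val x' - \val y| < e'].
  by rewrite -(@initial_ballE R (Rplus R : Type) R set_val) set_valE.
have /cvgrPdist_lt/(_ e e0)/nbhs_ballP[d d0 xd] := phic x.
exists d => // y xy; rewrite !val_clamp //.
by have := xd y; rewrite ballE; exact.
Qed.

Lemma dim_control_val_continuous c f : dim_control c f ->
  continuous (fun x => \val (f x) : R).
Proof.
move=> [_ fc _ _] x; apply: (@continuous_comp _ _ _ f (fun x => \val x : R)).
  exact: fc.
exact: val_Rplus_continuous.
Qed.

Lemma dim_control_clamp c (phi : Rplus R -> R) :
    (forall x y, \val x < \val y -> phi x < phi y) -> continuous phi ->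
    (forall x, \val x <= phi x) ->
    (c = Small -> forall x, \val x = 0 -> phi x = 0) ->
  dim_control c (fun x => clamp (phi x)).
Proof.
move=> phi_lt phic phi_ge phi0.
have pos x : 0 <= phi x by exact: le_trans (Rplus_ge0 x) (phi_ge x).
split.
- by move=> x y xy; rewrite !val_clamp //; exact: phi_lt.
- exact: clamp_continuous.
- by apply: near_scaleT => x _; rewrite val_clamp.
- case: c phi0 => [_ M|phi0 x x0]; last by rewrite val_clamp ?phi0.
  exists (Num.max 1 M) => [|x]; first by rewrite lt_max ltr01.
  by rewrite ge_max val_clamp // => /andP[_ /le_trans]; exact.
Qed.

(* The sum is locally finite, since the n-th summand vanishes on [0, n]. *)
Lemma strict_bound_large (f : nat -> Rplus R -> Rplus R) :
    (forall n, dim_control Large (f n)) ->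
  exists2 g, dim_control Large g &
    forall n, near_scale Large (fun x => \val (f n x) < \val (g x)).
Proof.
move=> fc; pose h n x : R := Num.max 0 (\val (f n x) - \val (f n (clamp n%:R))).
have h0 n x : \val x <= n%:R -> h n x = 0.
  move=> xn; apply/max_idPl; rewrite subr_le0; apply: (dim_control_le (fc n)).
  by rewrite val_clamp.
have h_le n x y : \val x <= \val y -> h n x <= h n y.
  move=> xy; rewrite ge_max !le_max lexx /= lerD2r.
  by rewrite (dim_control_le (fc n) xy) orbT.
have hpos n x : 0 <= h n x by rewrite le_max lexx.
have hc n : continuous (h n).
  move=> x; apply: (@continuous_max R (Rplus R) (cst 0)); first exact: cst_continuous.
  apply: continuous_add; first exact: dim_control_val_continuous (fc n).
  by move=> y; exact: cst_continuous.
(* The term [\val x] gives strict monotonicity and, for large [x], absorbs the constant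
   [\val (f n (clamp n%:R))] subtracted in [h n]. *)
pose S N x : R := \val x + 1 + \sum_(0 <= n < N) h n x.
have Sc N : continuous (S N).
  apply: continuous_add; first apply: continuous_add.
  - exact: val_Rplus_continuous.
  - by move=> x; exact: cst_continuous.
  - by apply: (@continuous_big R^o nat +%R) => // ; exact: add_continuous.
have S_stable N M x : \val x <= N%:R -> (N <= M)%N -> S M x = S N x.
  move=> xN NM; congr (_ + _); rewrite (big_cat_nat _ NM) //=.
  rewrite [X in _ + X]big1_seq ?addr0 //.
  move=> n /=; rewrite mem_index_iota => /andP[Nn _]; apply: h0.
  by rewrite (le_trans xN) // ler_nat.
have truncle x : \val x <= (Num.trunc (\val x)).+1%:R.
  by apply/ltW; rewrite -truncn_lt_nat ?Rplus_ge0.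
(* Every number of summands at least [\val x] gives the same value, so [phi] agrees with one fixed
   finite sum around each point. *)
pose phi x := S (Num.trunc (\val x)).+1 x.
have phiE N x : \val x <= N%:R -> phi x = S N x.
  move=> xN; case: (leqP N (Num.trunc (\val x)).+1) => [|/ltnW] le.
    exact: S_stable.
  by apply/esym/S_stable.
have phi_ge x : \val x + 1 <= phi x by rewrite lerDl sumr_ge0.
have gc : dim_control Large (fun x => clamp (phi x)).
  apply: dim_control_clamp => //.
  - move=> x y xy; have yN := truncle y; set N := _.+1 in yN.
    rewrite (phiE N y) // (phiE N x); last exact/ltW/(lt_le_trans xy).
    by rewrite ltr_leD ?ltrD2r // ler_sum // => n _; exact/h_le/ltW.
  - move=> x; set N := (Num.trunc (\val x)).+1.
    have xN : \val x < N%:R by rewrite -truncn_lt_nat ?Rplus_ge0.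
    apply: near_eq_continuous_at (@val_Rplus_continuous x _ (lt_nbhsl xN)) _ (Sc N x).
    by move=> y /set_mem/= /ltW/phiE.
  - by move=> x; apply: le_trans (phi_ge x); rewrite lerDl.
exists (fun x => clamp (phi x)) => // n.
exists (\val (f n (clamp n%:R)) + 1) => [|x nx].
  by rewrite ltr_pwDr // Rplus_ge0.
rewrite val_clamp; last by apply: le_trans (phi_ge x); rewrite addr_ge0 ?Rplus_ge0.
(* Large enough both for [phi x = S N x] and for the [n]-th summand to occur. *)
pose N := maxn (Num.trunc (\val x)).+1 n.+1.
rewrite (phiE N); last by rewrite (le_trans (truncle x)) // ler_nat leq_maxl.
have nN : (n < N)%N by exact: leq_maxr.
have hS : h n x <= \sum_(0 <= m < N) h m x.
  by rewrite big_mkord (bigD1 (Ordinal nN)) //= lerDl sumr_ge0.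
have fh : \val (f n x) - \val (f n (clamp n%:R)) <= h n x.
  by rewrite le_max lexx orbT.
by rewrite /S; move: nx hS fh; lra.
Qed.

Lemma sup_vanishing_ub (T : Type) (h : nat -> T -> R) n t :
  (forall n t, 0 <= h n t <= n.+1%:R^-1) -> h n t <= sup (range (h ^~ t)).
Proof.
move=> hb; apply: ub_le_sup; last by exists n.
exists 1 => _ [m _ <-]; have /andP[_ /le_trans] := hb m t; apply.
by rewrite invf_le1 ?ltr0n // ler1n.
Qed.

(* The bound [1 / (n + 1)] makes the supremum a uniform limit of finite maxima. *)
Lemma sup_vanishing_continuous (T : topologicalType) (h : nat -> T -> R) :
    (forall n t, 0 <= h n t <= n.+1%:R^-1) -> (forall n, continuous (h n)) ->
  continuous (fun t => sup (range (h ^~ t))).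
Proof.
move=> hb hc t; apply/cvgrPdist_le => e e0.
have s_ub u M : (forall n, h n u <= M) -> sup (range (h ^~ u)) <= M.
  by move=> hM; apply: ge_sup => [|_ [n _ <-]//]; exists (h 0%N u), 0%N.
have [N Ne] : exists N, N.+1%:R^-1 < e.
  exists (Num.trunc e^-1); rewrite invf_plt ?posrE //.
  by rewrite -truncn_lt_nat // invr_ge0 ltW.
(* Only finitely many indices need continuity at [t]: for [n >= N] all values of [h n] lie in
   [[0, e]]. *)
have : \forall u \near t, forall n : 'I_N, `|h n t - h n u| <= e.
  by apply: filter_forall => n; have /cvgrPdist_le/(_ e e0) := hc n t.
apply: filterS => u hN.
have {}hN n : `|h n t - h n u| <= e.
  have [nN|Nn] := ltnP n N; first exact: (hN (Ordinal nN)).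
  have ne : n.+1%:R^-1 <= e.
    by rewrite (le_trans _ (ltW Ne)) // lef_pV2 ?posrE ?ltr0n // ler_nat.
  move: (hb n t) (hb n u) ne; move: (n.+1%:R^-1) => r /andP[t0 tr] /andP[u0 ur] re.
  by rewrite ler_norml; apply/andP; split; lra.
have tu : sup (range (h ^~ t)) <= sup (range (h ^~ u)) + e.
  apply: s_ub => n; have := sup_vanishing_ub n u hb; have := hN n.
  by rewrite ler_norml => /andP[_]; lra.
have ut : sup (range (h ^~ u)) <= sup (range (h ^~ t)) + e.
  apply: s_ub => n; have := sup_vanishing_ub n t hb; have := hN n.
  by rewrite ler_norml => /andP[+ _]; lra.
by rewrite ler_norml; apply/andP; split; lra.
Qed.

(** Capping [f n] at [1 / (n + 1)] keeps the supremum continuous, and changes nothing near 0, where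
    [f n] falls below its cap. Adding [\val x] makes the bound strict and strictly increasing. *)
Lemma strict_bound_small (f : nat -> Rplus R -> Rplus R) :
    (forall n, dim_control Small (f n)) ->
  exists2 g, dim_control Small g &
    forall n, near_scale Small (fun x => \val (f n x) < \val (g x)).
Proof.
move=> fc; pose h n x : R := Num.min (\val (f n x)) n.+1%:R^-1.
have hpos n x : 0 <= h n x by rewrite le_min Rplus_ge0 invr_ge0 ler0n.
have h1 n x : h n x <= n.+1%:R^-1 by rewrite ge_min lexx orbT.
have h_le n x y : \val x <= \val y -> h n x <= h n y.
  by move=> xy; rewrite le_min h1 andbT ge_min (dim_control_le (fc n) xy).
have hc n : continuous (h n).
  move=> x; apply: (@continuous_min R (Rplus R) (fun y => \val (f n y)) (cst n.+1%:R^-1)).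
    exact: dim_control_val_continuous (fc n) x.
  exact: cst_continuous.
pose s x := sup (range (h ^~ x)).
have hb n x : 0 <= h n x <= n.+1%:R^-1 by rewrite hpos h1.
have hs n x : h n x <= s x := sup_vanishing_ub n x hb.
have s_ub x M : (forall n, h n x <= M) -> s x <= M.
  by move=> hM; apply: ge_sup => [|_ [n _ <-]//]; exists (h 0%N x), 0%N.
have sc : continuous s := sup_vanishing_continuous hb hc.
have spos x : 0 <= s x by exact: le_trans (hpos 0%N x) (hs 0%N x).
have gc : dim_control Small (fun x => clamp (\val x + s x)).
  apply: dim_control_clamp => //.
  - move=> x y xy; rewrite ltr_leD //; apply: s_ub => n.
    by apply: le_trans (hs n y); exact/h_le/ltW.
  - by apply: continuous_add; [exact: val_Rplus_continuous|exact: sc].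
  - by move=> x; rewrite lerDl.
  - move=> _ x x0; rewrite x0 add0r; apply/eqP; rewrite eq_le spos andbT.
    apply: s_ub => n; have [_ _ _ f0] := fc n.
    by rewrite /h f0 // ge_min lexx.
exists (fun x => clamp (\val x + s x)) => // n.
have : near_scale Small (fun x => \val (f n x) < n.+1%:R^-1).
  by apply: dim_control_small => //; rewrite invr_gt0 ltr0n.
apply: near_scaleS => x x0 fx; rewrite val_clamp ?addr_ge0 ?Rplus_ge0 //.
rewrite ltr_pwDl //; apply: le_trans (hs n x).
by rewrite le_min lexx ltW.
Qed.

Lemma strict_bound c (A : set (Rplus R -> Rplus R)) : countable A ->
    (forall f, A f -> dim_control c f) ->
  exists2 g, dim_control c g &
    forall f, A f -> near_scale c (fun x => \val (f x) < \val (g x)).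
Proof.
move=> /countable_injP[i iinj] Ac.
(* Turns [A] into a sequence; indices outside the image of [i] are filled with the identity, a
   harmless dim-control function. *)
have /choice[e eP] : forall n, exists g, dim_control c g /\
    forall f, A f -> i f = n -> f = g.
  move=> n; have [[g [Ag gn]]|N] := pselect (exists g, A g /\ i g = n).
    exists g; split=> [|f Af fn]; first exact: Ac.
    by apply: iinj; rewrite ?inE // fn gn.
  exists id; split=> [|f Af fn]; first exact: dim_control_id.
  by case: N; exists f.
have [g gc ge] : exists2 g, dim_control c g &
    forall n, near_scale c (fun x => \val (e n x) < \val (g x)).
  case: c Ac eP => _ eP; [apply: strict_bound_large|apply: strict_bound_small];
    by move=> n; have [] := eP n.
exists g => // f Af; have [_ /(_ f Af erefl) ->] := eP (i f); exact: ge.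
Qed.

Lemma dim_control_double c : dim_control c (fun x => clamp (\val x + \val x)).
Proof.
apply: dim_control_clamp.
- by move=> x y xy; rewrite ltrD.
- by apply: continuous_add; exact: val_Rplus_continuous.
- by move=> x; rewrite lerDl Rplus_ge0.
- by move=> _ x ->; rewrite addr0.
Qed.

(** The requirements on one stage of the tower over the earlier ones: doubling lets iterates of [g]
    overtake all linear functions, and passing every iterate of the members of [A] separates the
    semigroups. *)
Definition strictly_above c (A : set (Rplus R -> Rplus R)) g :=
  [/\ dim_control c g, near_scale c (fun x => \val x + \val x <= \val (g x)) &
    forall f n, A f -> near_scale c (fun x => \val (iter n f x) < \val (g x))].

Lemma strictly_above_ex c (A : set (Rplus R -> Rplus R)) : countable A ->
  (forall f, A f -> dim_control c f) -> exists g, strictly_above c A g.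
Proof.
move=> cA Ac.
(* The iterates of members of [A] still form a countable family; twice a strict bound of it also
   meets the doubling condition. *)
have [||g gc gA] := @strict_bound c (\bigcup_n [set iter n f | f in A]).
- by apply: bigcup_countable => // n _; apply: sub_countable cA; exact: card_image_le.
- by move=> _ [n _ [f Af <-]]; exact/dim_control_iter/Ac.
exists (fun x => clamp (\val (g x) + \val (g x))).
have g0 x : 0 <= \val (g x) by exact: Rplus_ge0.
split=> [||f n Af].
- exact: dim_control_comp (dim_control_double c) gc.
- apply: near_scaleS (dim_control_ge gc) => x _ xg.
  by rewrite val_clamp ?addr_ge0 // lerD.
- have : near_scale c (fun x => \val (iter n f x) < \val (g x)).
    by apply: gA; exists n => //; exists f.
  apply: near_scaleS => x _ /lt_le_trans; apply.
  by rewrite val_clamp ?addr_ge0 // lerDl.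
Qed.

End Bounds.

(** * The tower of semigroups *)

Section Tower.
Context {R : realType}.
Implicit Types (x y : Rplus R) (f g h : Rplus R -> Rplus R) (c : scale).

Lemma tower_ex c : exists F : countable_ordinal -> Rplus R -> Rplus R,
  forall a, strictly_above c [set F b | b in countable_ordinal_lt ^~ a] (F a).
Proof.
(* The selector is total, with the identity as default, so the recursion can be run first; that its
   values are dim-control functions is proved afterwards by induction. *)
have /choice[sel selP] : forall A : set (Rplus R -> Rplus R), exists g,
    countable A -> (forall f, A f -> dim_control c f) -> strictly_above c A g.
  move=> A; have [H|N] := pselect (countable A /\ forall f, A f -> dim_control c f).
    by have [g gA] := strictly_above_ex H.1 H.2; exists g.
  by exists id => cA Ac; case: N.
pose step a (F : forall b, countable_ordinal_lt b a -> Rplus R -> Rplus R) :=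
  sel [set g | exists b (ba : countable_ordinal_lt b a), g = F b ba].
pose F := Fix countable_ordinal_lt_wf _ step.
have FE a : F a = sel [set F b | b in countable_ordinal_lt ^~ a].
  rewrite /F Fix_eq; last first.
    by move=> x F1 F2 F12; congr step; do 2!apply: functional_extensionality_dep => ?.
  congr sel; apply/seteqP; split=> [_ [b [ba ->]]|_ [b ba <-]]; first by exists b.
  by exists b, ba.
exists F => a; elim: {a}(countable_ordinal_lt_wf a) => a _ IH; rewrite FE.
apply: selP => [|_ [b ba <-]]; last by have [] := IH b ba.
by apply: sub_countable (countable_initial a); exact: card_image_le.
Qed.

Lemma near_scale_iter_double c f n : dim_control c f ->
    near_scale c (fun x => \val x + \val x <= \val (f x)) ->
  near_scale c (fun x => 2%:R ^+ n * \val x <= \val (iter n f x)).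
Proof.
move=> fc f2; elim: n => [|n IH].
  by apply: near_scaleT => x _; rewrite expr0 mul1r.
have := near_scaleI IH (near_scale_preimage (dim_control_iter n fc) f2).
apply: near_scaleS => x _ [fx /(le_trans _)]; apply.
by rewrite exprS -mulrA mulr_natl mulr2n lerD.
Qed.

(** At the large scale [\val x >= 1] absorbs the constant term; at the small scale [f] tends to 0,
    which excludes a positive constant term. *)
Lemma scale_linear_le c f : dim_control c f -> scale_linear c f ->
  exists M : R, near_scale c (fun x => \val (f x) <= M * \val x).
Proof.
move=> fc [a [b fab]]; case: c fc fab => fc fab.
  exists (`|a| + `|b|).
  have n1 : near_scale Large (fun x : Rplus R => 1 <= \val x) by exists 1.
  apply: near_scaleS (near_scaleI fab n1) => x _ [-> x1].
  rewrite mulrDl lerD ?ler_wpM2r ?Rplus_ge0 ?ler_norm //.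
  by rewrite (le_trans (ler_norm b)) // ler_peMr.
exists a; have [b0|b0] := leP b 0.
  by apply: near_scaleS fab => x _ ->; lra.
have b2 : 0 < b / 2 by rewrite divr_gt0.
(* For positive [x] up to this value, [a * x > - b / 2], so [f x > b / 2], against [f x < b / 2]
   near 0. *)
have d0 : 0 < b / 2 / (`|a| + 1) by rewrite divr_gt0 // ltr_pwDr.
have nx : near_scale Small (fun x : Rplus R => \val x <= b / 2 / (`|a| + 1)).
  by exists (b / 2 / (`|a| + 1)) => // x /andP[].
have [x x0 [[fx xa] fxe]] :=
  near_scale_ex (near_scaleI (near_scaleI fab nx) (dim_control_small fc b2)).
move: xa; rewrite ler_pdivlMr ?ltr_pwDr // => xa.
have : - (\val x * `|a|) <= a * \val x.
  by rewrite lerNl -mulNr mulrC ler_wpM2l ?Rplus_ge0 // -normrN ler_norm.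
move: x0 xa fxe; rewrite fx mulrDr mulr1.
set u := \val x * `|a|; set v := a * \val x; move: (\val x) => w; lra.
Qed.

Lemma ex_exp2_ge (M : R) : exists n, M <= 2%:R ^+ n.
Proof.
exists (Num.trunc `|M|).+1; apply: (le_trans (ler_norm M)).
apply: (@le_trans _ _ (Num.trunc `|M|).+1%:R).
  by apply/ltW; rewrite -truncn_lt_nat.
by rewrite -natrX ler_nat; apply/ltnW/ltn_expl.
Qed.

(** Admitting all iterates gives stability under composition: bounds by [iter m f] and [iter n f]
    compose to one by [iter (m + n) f]. *)
Definition dominated c f g :=
  dim_control c g /\ exists n, near_scale c (fun x => \val (g x) <= \val (iter n f x)).

(** The [n]-th iterate of [f] is at least [2 ^ n * x] near the scale, which exceeds any given slope
    for suitable [n]. *)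
Lemma dominated_linear c f g : dim_control c f ->
    near_scale c (fun x => \val x + \val x <= \val (f x)) ->
  dim_control c g -> scale_linear c g -> dominated c f g.
Proof.
move=> fc f2 gc glin; split=> //.
have [M gM] := scale_linear_le gc glin; have [n Mn] := ex_exp2_ge M.
exists n; apply: near_scaleS (near_scaleI gM (near_scale_iter_double n fc f2)).
move=> x _ [/le_trans gMx /(le_trans _)]; apply; apply: gMx.
by rewrite ler_wpM2r ?Rplus_ge0.
Qed.

Lemma dominated_comp c f g h : dim_control c f -> dominated c f g ->
  dominated c f h -> dominated c f (g \o h).
Proof.
move=> fc [gc [m gm]] [hc [n hn]]; split; first exact: dim_control_comp.
exists (m + n)%N; apply: near_scaleS (near_scaleI hn (near_scale_preimage hc gm)).
move=> x _ [hx /le_trans]; apply; rewrite iterD.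
exact: dim_control_le (dim_control_iter m fc) hx.
Qed.

Definition dominated_semigroup c f (fc : dim_control c f)
    (f2 : near_scale c (fun x => \val x + \val x <= \val (f x))) :
  control_semigroup R c.
Proof.
exists [set g | dominated c f g].
- by move=> g [].
- by move=> g; exact: dominated_linear.
- by move=> g h; exact: dominated_comp.
Defined.

Definition full_semigroup c : control_semigroup R c.
Proof.
exists [set g | dim_control c g] => //.
by move=> f g; exact: dim_control_comp.
Defined.

Lemma semigroup_tower c : exists S : Omega -> control_semigroup R c,
  (forall a, mono_bounded (S (Some a))) /\
  (forall a b, Omega_lt a b -> csg_lt (S b) (S a)).
Proof.
have [F FP] := tower_ex c.
have Fc a : dim_control c (F a) by have [] := FP a.
have F2 a : near_scale c (fun x => \val x + \val x <= \val (F a x)).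
  by have [] := FP a.
have Fab n a b : countable_ordinal_lt a b ->
    near_scale c (fun x => \val (iter n (F a) x) < \val (F b x)).
  by move=> ab; have [_ _] := FP b; apply; exists a.
pose S (a : Omega) := if a is Some a then dominated_semigroup (Fc a) (F2 a)
                      else full_semigroup c.
(* One function above all iterates of [F a] serves twice: it mono-bounds the semigroup of [a], and
   it separates that semigroup from the full one. *)
have above a : exists2 g, dim_control c g & forall n,
    near_scale c (fun x => \val (iter n (F a) x) < \val (g x)).
  have [_ ->|g [gc _ gA]] := @strictly_above_ex R c [set F a] (countable1 _).
    exact: Fc.
  by exists g => // n; apply: gA.
have not_dominated a g h : (forall n,
      near_scale c (fun x => \val (iter n (F a) x) < \val (g x))) ->
    dominated c (F a) h -> ~ near_scale c (fun x => \val (g x) <= \val (h x)).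
  move=> Fg [_ [n hn]] gh.
  have [x _ [[]]] := near_scale_ex (near_scaleI (near_scaleI hn gh) (Fg n)).
  by move=> hF gx; rewrite ltNge (le_trans gx hF).
exists S; split=> [a|[a|] [b|] //= ab].
- have [g gc Fg] := above a; exists g => // h [_ [n hn]].
  apply: near_scaleS (near_scaleI hn (Fg n)) => x _ [hx]; exact: le_lt_trans.
(* A function below an iterate of [F a] is below [F b], hence lies in the semigroup of [b]; [F b]
   itself witnesses strictness. *)
- split=> [h [hc [n hn]]|[_ /(_ (F b))]].
    exists h; last exact: near_scaleT.
    split=> //; exists 1%N; apply: near_scaleS (near_scaleI hn (Fab n _ _ ab)).
    by move=> x _ [hx /ltW]; exact: le_trans.
  case=> [|h hF]; first by split=> //; exists 1%N; exact: near_scaleT.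
  by apply: not_dominated hF => n; exact: Fab.
- split=> [h [hc _]|[_]]; first by exists h => //; exact: near_scaleT.
  by have [g gc Fg] := above a; move=> /(_ g gc)[h hF]; exact: not_dominated hF.
Qed.

End Tower.

(** * Separating semigroups by metric spaces *)

Section ChainSpace.
Context {R : realType}.
Implicit Types (x y : Rplus R) (f g h : Rplus R -> Rplus R) (c : scale).

(** The pair [(t, k)] is the [k]-th point of a chain of step [t], whose length is kept at most
    [g t]. There is one chain for each [t > 0], so a single space tests all scales. *)
Definition chain_space g (gpos : forall x, 0 < \val x -> 0 < \val (g x)) : Type :=
  {p : Rplus R * nat | (0 < \val p.1) && (p.2%:R * \val p.1 <= \val (g p.1))}.

Section Metric.
Variables (g : Rplus R -> Rplus R) (gpos : forall x, 0 < \val x -> 0 < \val (g x)).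
Implicit Types p q r : chain_space gpos.

Definition chain p : Rplus R := (\val p).1.
Definition rank p : nat := (\val p).2.

(** Distinct chains are placed at the larger of their length bounds: leaving a chain costs at least
    as much as crossing it, as the triangle inequality demands. *)
Definition chain_dist p q : R :=
  if chain p == chain q then `|(rank p)%:R - (rank q)%:R| * \val (chain p)
  else Num.max (\val (g (chain p))) (\val (g (chain q))).

Lemma chain_gt0 p : 0 < \val (chain p).
Proof. by have /andP[] := valP p. Qed.

Lemma chain_dist_le p q : chain p = chain q -> chain_dist p q <= \val (g (chain p)).
Proof.
move=> e; rewrite /chain_dist e eqxx.
have p0 := chain_gt0 p; have /andP[_ pg] := valP p; have /andP[_ qg] := valP q.
have p0' : 0 <= (rank p)%:R * \val (chain p) by rewrite mulr_ge0 ?ler0n ?Rplus_ge0.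
have q0' : 0 <= (rank q)%:R * \val (chain p) by rewrite mulr_ge0 ?ler0n ?Rplus_ge0.
move: pg qg p0' q0'; rewrite -/(chain p) -/(chain q) -/(rank p) -/(rank q) -e.
move=> pg qg p0' q0'.
rewrite -[X in _ * X]gtr0_norm // -normrM mulrBl ler_norml.
by apply/andP; split; lra.
Qed.

Lemma chain_distxx p : chain_dist p p = 0.
Proof. by rewrite /chain_dist eqxx subrr normr0 mul0r. Qed.

Lemma chain_dist_eq0 p q : chain_dist p q = 0 -> p = q.
Proof.
rewrite /chain_dist; case: eqP => [e|_] /eqP.
  rewrite mulf_eq0 (gt_eqF (chain_gt0 p)) orbF normr_eq0 subr_eq0 eqr_nat => /eqP r.
  apply: val_inj; move: e r; rewrite /chain /rank.
  by case: (\val p) (\val q) => [a b] [a' b'] /= -> ->.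
move=> /eqP m0; have := gpos (chain_gt0 p).
by rewrite ltNge -m0 le_max lexx.
Qed.

Lemma chain_distC p q : chain_dist p q = chain_dist q p.
Proof.
rewrite /chain_dist eq_sym; case: eqP => [->|_]; last by rewrite maxC.
by rewrite distrC.
Qed.

Lemma chain_dist_triangle q p r : chain_dist p r <= chain_dist p q + chain_dist q r.
Proof.
have pos s t : 0 <= chain_dist s t.
  rewrite /chain_dist; case: ifP => _; first by rewrite mulr_ge0 ?Rplus_ge0.
  by rewrite le_max Rplus_ge0.
have [pr|pr] := eqVneq (chain p) (chain r).
  have [pq|pq] := eqVneq (chain p) (chain q).
    rewrite /chain_dist -pr -pq eqxx -mulrDl ler_wpM2r ?Rplus_ge0 //.
    exact: ler_distD.
  apply: (le_trans (chain_dist_le pr)).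
  rewrite -[leLHS]addr0 lerD ?pos // /chain_dist (negPf pq).
  by rewrite le_max lexx.
have [pq|pq] := eqVneq (chain p) (chain q).
  by rewrite {1 3}/chain_dist -pq (negPf pr) lerDr.
have [qr|qr] := eqVneq (chain q) (chain r).
  by rewrite {1 2}/chain_dist (negPf pr) (negPf pq) qr lerDl.
rewrite /chain_dist (negPf pr) (negPf pq) (negPf qr).
have := Rplus_ge0 (g (chain p)); have := Rplus_ge0 (g (chain r)).
set a := \val (g (chain p)); set b := \val (g (chain q)); set d := \val (g (chain r)).
move=> d0 a0; have : 0 <= Num.max a b by rewrite le_max a0.
have : 0 <= Num.max b d by rewrite le_max d0 orbT.
have : a <= Num.max a b by rewrite le_max lexx.
have : d <= Num.max b d by rewrite le_max lexx orbT.
by rewrite ge_max => *; apply/andP; split; lra.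
Qed.

HB.instance Definition _ := gen_eqMixin (chain_space gpos).
HB.instance Definition _ := gen_choiceMixin (chain_space gpos).
HB.instance Definition _ := isMetric.Build R (chain_space gpos)
  chain_distxx chain_dist_eq0 chain_distC chain_dist_triangle.

End Metric.

Lemma mdist_chain g gpos (p q : @chain_space g gpos) : mdist p q = chain_dist p q.
Proof. by []. Qed.

(** The infimum runs over natural numbers, so it can be 0 only if 0 occurs; otherwise it is at least
    1. *)
Lemma sdim_le0P c (S : control_semigroup R c) (X : metricType R) :
  sdim_le S X 0 <-> sdim S X = 0%E.
Proof.
have ge0 : (0 <= sdim S X)%E.
  by apply: le_ereal_inf_tmp => _ [n _ <-]; rewrite lee_fin ler0n.
split=> [S0|].
  apply/eqP; rewrite eq_le ge0 andbT.
  by apply: ereal_inf_lbound; exists 0%N.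
move=> S0; apply: contrapT => N0.
suff : (1 <= sdim S X)%E by rewrite S0 lee_fin ler10.
apply: le_ereal_inf_tmp => _ [n Sn <-]; rewrite lee_fin ler1n lt0n.
by apply: contra_not_neq N0 => <-.
Qed.

(* The clusters at scale s are the fibers of this map: a single one gathering
   all chains of length at most s, the longer chains of step at most s, and
   the points of the other chains. *)
Definition cluster g gpos (s : Rplus R) (p : @chain_space g gpos) :
    option (Rplus R * nat) :=
  if \val (g (chain p)) <= \val s then None
  else Some (chain p, if \val (chain p) <= \val s then 0%N else rank p).

(** A uniform [t] above [s] is needed because the distance of two sets is an infimum: distances
    merely exceeding [s] pointwise would not make it exceed [s]. *)
Lemma cluster_far g gpos s (p : @chain_space g gpos) : cluster s p <> None ->
  exists2 t, \val s < t & forall u v : chain_space gpos, cluster s u = cluster s p ->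
    cluster s v <> cluster s p -> t <= mdist u v.
Proof.
(* If the step is at most [s], the cluster is a whole chain and only other chains matter. Otherwise
   it is a single point, whose neighbours on its chain are one step away. *)
pose t := if \val (chain p) <= \val s then \val (g (chain p))
          else Num.min (\val (chain p)) (\val (g (chain p))).
rewrite /cluster; case: (leP (\val (g (chain p)))) => // sgp _.
exists t => [|u v].
  rewrite /t; case: (leP (\val (chain p))) => // sp.
  by rewrite lt_min sgp andbT.
have tg : t <= \val (g (chain p)).
  by rewrite /t; case: ifP => // _; rewrite ge_min lexx orbT.
case: (leP (\val (g (chain u)))) => // sgu [up].
rewrite up mdist_chain /chain_dist up.
case: eqP => [<-|pNv _ _]; last by rewrite le_max tg.
rewrite (leNgt (\val (g (chain p)))) sgp /t /=.
case: (leP (\val (chain p))) => [_ _ /(_ erefl)//|sp -> vNp].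
rewrite ge_min; apply/orP; left; rewrite ler_peMl ?Rplus_ge0 //.
have : rank p != rank v by apply: contra_not_neq vNp => ->.
rewrite neq_ltn ler_normr opprB => /orP[] lt; apply/orP; [right|left];
  by rewrite lerBrDr nat1r ler_nat.
Qed.

(** In the gathered cluster distances are at most [s]; a whole chain of step at most [s] has length
    at most [g s] by monotonicity; the other clusters are points. *)
Lemma cluster_bounded c g gpos s (p q : @chain_space g gpos) :
    dim_control c g -> \val s <= \val (g s) ->
  cluster s p = cluster s q -> mdist p q <= \val (g s).
Proof.
move=> gc sgs; rewrite /cluster mdist_chain.
case: (leP (\val (g (chain p)))) => gps; case: (leP (\val (g (chain q)))) => gqs //.
  move=> _; apply: le_trans sgs; have [e|ne] := eqVneq (chain p) (chain q).
    exact: le_trans (chain_dist_le e) gps.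
  by rewrite /chain_dist (negPf ne) ge_max gps.
case=> e; rewrite -e; case: leP => [ps _|_ r].
  exact: le_trans (chain_dist_le e) (dim_control_le gc ps).
by rewrite /chain_dist e eqxx r subrr normr0 mul0r Rplus_ge0.
Qed.

Lemma chain_space_sdim0 c (S : control_semigroup R c) g gpos :
  csg_set S g -> sdim S (@chain_space g gpos) = 0%E.
Proof.
move=> Sg; have gc := csg_control Sg; apply/sdim_le0P; exists g => //.
apply: near_scaleS (dim_control_ge gc) => s s0 sgs.
pose fiber (p : chain_space gpos) :=
  [set q : chain_space gpos | cluster s q = cluster s p].
exists (fun=> range fiber); split.
  apply/seteqP; split=> // p _.
  by exists (fiber p) => //; exists ord0 => //; exists p.
move=> i; split=> [_ _ [p _ <-] [q _ <-] pNq|_ [p _ <-]]; last first.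
  apply: ge_ereal_sup => _ [u /= up [v /= vp <-]].
  by rewrite lee_fin (cluster_bounded gc) // up vp.
have {}pNq : cluster s p <> cluster s q by apply: contra_not pNq; rewrite /fiber => ->.
(* Of two distinct clusters at most one is the gathered one, so [cluster_far] applies to the
   other. *)
have [t st far] : exists2 t, \val s < t & forall u v : chain_space gpos,
    cluster s u = cluster s p -> cluster s v = cluster s q -> t <= mdist u v.
  have [p0|/eqP p0] := eqVneq (cluster s p) None.
    have q0 : cluster s q <> None by rewrite -p0; exact/nesym.
    have [t st far] := cluster_far q0; exists t => // u v up vq.
    by rewrite metric_sym far // up.
  have [t st far] := cluster_far p0; exists t => // u v up vq.
  by rewrite far // vq; exact/nesym.
apply: (@lt_le_trans _ _ t%:E); first by rewrite lte_fin.
by apply: le_ereal_inf_tmp => _ [u up [v vq <-]]; rewrite lee_fin far.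
Qed.

(** Neighbours on the chain of step [s] are at distance exactly [s], so [s]-disjointness forces the
    whole chain into one member, of diameter at most [f0]. The chain length misses [g s] by less
    than one step [s <= f0]. *)
Lemma chain_space_cover_le g gpos s (f0 : R) (U : set (set (@chain_space g gpos))) :
    0 < \val s -> \val s <= f0 -> \bigcup_(V in U) V = setT ->
    disjoint_family (\val s) U -> bounded_family f0 U ->
  \val (g s) <= f0 + f0.
Proof.
move=> s0 sf cov dis bnd.
pose N := Num.trunc (\val (g s) / \val s).
have pt k : (k <= N)%N -> exists p : chain_space gpos, chain p = s /\ rank p = k.
  move=> kN; have P : (0 < \val s) && (k%:R * \val s <= \val (g s)).
    rewrite s0 -ler_pdivlMr //.
    apply: (@le_trans _ _ N%:R); first by rewrite ler_nat.
    by rewrite truncn_le ?divr_ge0 ?Rplus_ge0.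
  by exists (exist (fun p : Rplus R * nat => (0 < \val p.1) &&
    (p.2%:R * \val p.1 <= \val (g p.1))) (s, k) P).
have [z [zc z0]] := pt 0%N isT.
have [V UV Vz] : (\bigcup_(V in U) V) z by rewrite cov.
have VN k p : (k <= N)%N -> chain p = s -> rank p = k -> V p.
  elim: k p => [|k IH] p kN pc pr.
    suff -> : p = z by [].
    by apply: chain_dist_eq0; rewrite /chain_dist pc zc eqxx pr z0 subrr normr0 mul0r.
  have [q [qc qr]] := pt k (ltnW kN); have Vq := IH q (ltnW kN) qc qr.
  have [W UW Wp] : (\bigcup_(V in U) V) p by rewrite cov.
  have [<-//|NVW] := pselect (W = V).
  have := dis _ _ UW UV NVW; rewrite ltNge => /negP[].
  apply: ereal_inf_lbound; exists p => //; exists q => //.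
  rewrite mdist_chain /chain_dist pc qc eqxx pr qr -natr1 addrAC subrr add0r.
  by rewrite normr1 mul1r.
have [p [pc pr]] := pt N (leqnn N).
have : mdist p z <= f0.
  rewrite -lee_fin; apply: le_trans (bnd _ UV); apply: ereal_sup_ubound.
  by exists p; [exact: VN pc pr|exists z].
rewrite mdist_chain /chain_dist pc zc eqxx pr z0 subr0 ger0_norm ?ler0n // => Nf.
have : \val (g s) / \val s < N.+1%:R.
  by rewrite -truncn_lt_nat // divr_ge0 ?Rplus_ge0.
rewrite ltr_pdivrMr // -natr1 mulrDl mul1r.
by move: Nf; set a := _ * _; lra.
Qed.

(** The chain space of [g] has dimension 0 for [S2], hence for [S1], which yields [f] in [S1] with
    [g <= 2 f] near the scale. Doubling is linear, so [2 f] is again in [S1]. *)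
Lemma dim_equiv_csg_le c (S1 S2 : control_semigroup R c) :
  dim_equiv S1 S2 -> csg_le S1 S2.
Proof.
move=> /asboolP S12 g S2g; have gc := csg_control S2g.
have gpos x : 0 < \val x -> 0 < \val (g x) := @dim_control_gt0 _ _ _ x gc.
have /sdim_le0P[f S1f cov] : sdim S1 (chain_space gpos) = 0%E.
  by rewrite S12; exact: chain_space_sdim0.
have fc := csg_control S1f.
pose d x : Rplus R := clamp (\val x + \val x).
have S1d : csg_set S1 d.
  apply: csg_linear; first exact: dim_control_double.
  exists 2%:R, 0; apply: near_scaleT => x _.
  by rewrite val_clamp ?addr_ge0 ?Rplus_ge0 // addr0 mulr_natl mulr2n.
exists (d \o f); first exact: csg_comp.
apply: near_scaleS (near_scaleI cov (dim_control_ge fc)) => s s0 [[U [Ucov UP]] sf].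
rewrite val_clamp ?addr_ge0 ?Rplus_ge0 //; have [dis bnd] := UP ord0.
apply: chain_space_cover_le s0 sf _ dis bnd.
rewrite -Ucov; congr bigcup; apply/seteqP; split=> [V UV|V [i _]]; first by exists ord0.
by rewrite ord1.
Qed.

Lemma csg_lt_pi_neq c (S1 S2 : control_semigroup R c) : csg_lt S1 S2 ->
  \pi_({eq_quot @dim_equiv R c}) S1 <> \pi_({eq_quot @dim_equiv R c}) S2.
Proof.
move=> [_ N] /eqmodP S12; apply: N; split; apply: dim_equiv_csg_le => //.
by rewrite dim_equiv_sym.
Qed.

Lemma semigroup_tower_inj c (S : Omega -> control_semigroup R c) :
    (forall a b, Omega_lt a b -> csg_lt (S b) (S a)) ->
  injective (fun a => \pi_({eq_quot @dim_equiv R c}) (S a)).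
Proof.
move=> S_lt.
have lt a b : Omega_lt a b ->
    \pi_({eq_quot @dim_equiv R c}) (S a) <> \pi_({eq_quot @dim_equiv R c}) (S b).
  by move=> /S_lt/csg_lt_pi_neq/nesym.
move=> [a|] [b|] // e.
- have [ab|->//|ba] := countable_ordinal_trichotomy a b.
    by case: (lt (Some a) (Some b) ab).
  by case: (lt (Some b) (Some a) ba).
- by case: (lt (Some a) None I).
- by case: (lt (Some b) None I).
Qed.

End ChainSpace.

Theorem theorem5p12 (R : realType) :
  exists (iL : Omega -> ASDIM R) (iS : Omega -> SMDIM R),
    injective iL /\ injective iS /\
    exists (S : Omega -> control_semigroup R Large)
           (xi : Omega -> control_semigroup R Small),
      (forall a : Omega, iL a = asdim_class (S a)) /\
      (forall a : Omega, iS a = smdim_class (xi a)) /\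
      (forall a : countable_ordinal,
        mono_bounded (S (Some a)) /\ mono_bounded (xi (Some a))) /\
      (forall a b : Omega, Omega_lt a b ->
        csg_lt (S b) (S a) /\ csg_lt (xi b) (xi a)).
Proof.
have [S [Sb S_lt]] := @semigroup_tower R Large.
have [xi [xib xi_lt]] := @semigroup_tower R Small.
exists (fun a => asdim_class (S a)), (fun a => smdim_class (xi a)).
split; first exact: semigroup_tower_inj.
split; first exact: semigroup_tower_inj.
exists S, xi; do 2!split=> //; split=> [a|a b ab]; first by split.
by split; [exact: S_lt|exact: xi_lt].
Qed.
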